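(* Let $k\geq2$, and let $G$ be a $k$-chromatic $3$-graph of order $n$. For every real $p\geq1$, \[ \lambda^{(p)}(G)<\lambda^{(p)}(Q_k^3(n)), \] unless $G=Q_k^3(n)$ (up to isomorphism).
   Context: A $3$-graph of order $n$ is a $3$-uniform hypergraph with vertex set $[n]$. For an $r$-graph $G$, its polynomial form is $P_G([x_i])=r!\sum_{\{i_1,\ldots,i_r\}\in E(G)}x_{i_1}\cdots x_{i_r}$, and for real $p\geq1$ its $p$-spectral radius is $\lambda^{(p)}(G)=\max_{|x_1|^p+\cdots+|x_n|^p=1}P_G([x_i])$. An $r$-graph is $k$-chromatic if its vertex set can be partitioned into $k$ sets (vertex classes) so that no set contains an edge; an edge-maximal $k$-chromatic $r$-graph is complete $k$-chromatic (its edges are all $r$-sets not contained in a single class). $Q_k^r(n)$ denotes the complete $k$-chromatic $r$-graph of order $n$ with vertex classes of sizes $\lfloor n/k\rfloor$ or $\lceil n/k\rceil$. *)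

(* Defs.v *)
From HB Require Import structures.
From mathcomp Require Import all_boot all_order all_fingroup all_algebra.
From mathcomp Require Import zify.
From mathcomp Require Import all_classical all_reals all_analysis.

Set Implicit Arguments.
Unset Strict Implicit.
Unset Printing Implicit Defensive.
Import Order.TTheory GRing.Theory Num.Theory.
Import numFieldNormedType.Exports.

Record unif_hypergraph (r n : nat) := UnifHypergraph {
  edges :> {set {set 'I_n}};
  edges_uniform : [forall e in edges, #|e| == r] }.

Definition graph_iso (r n : nat) (G H : unif_hypergraph r n) : Prop :=
  exists s : {perm 'I_n}, edges H = [set s @: e | e : {set 'I_n} in edges G].

(* A partition of [n] into k vertex classes, some possibly empty, is given by
   the map sending each vertex to the index of its class. *)
Definition vclass (n k : nat) (f : {ffun 'I_n -> 'I_k}) (c : 'I_k) : {set 'I_n} :=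
  [set v | f v == c].

Definition chromatic (k r n : nat) (G : unif_hypergraph r n) : Prop :=
  exists f : {ffun 'I_n -> 'I_k},
    forall (e : {set 'I_n}) (c : 'I_k), e \in edges G -> ~~ (e \subset vclass f c).

Definition complete_chromatic_on (k r n : nat) (f : {ffun 'I_n -> 'I_k})
    (G : unif_hypergraph r n) : Prop :=
  edges G = [set e : {set 'I_n} | (#|e| == r) &
                                  [forall c : 'I_k, ~~ (e \subset vclass f c)]].

(* is_Q k Q : Q is (a copy of) Q_k^r(n); (n + k.-1) %/ k is the ceiling of n/k
   for k > 0. *)
Definition is_Q (k r n : nat) (Q : unif_hypergraph r n) : Prop :=
  exists f : {ffun 'I_n -> 'I_k},
    complete_chromatic_on f Q /\
    forall c : 'I_k, #|vclass f c| = n %/ k \/ #|vclass f c| = (n + k.-1) %/ k.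

Lemma sum_modn_eq (k c m : nat) :
  c < k -> \sum_(i < m) (i %% k == c) = (m + (k.-1 - c)) %/ k.
Proof.
move=> ck; have k0 : 0 < k by lia.
elim: m => [|m IH]; first by rewrite big_ord0 divn_small //; lia.
rewrite big_ord_recr /= IH.
have jk := ltn_pmod m k0; have := divn_eq m k.
set j := m %% k in jk *; set q := m %/ k => ->.
rewrite addSn -addnS -!addnA !divnMDl // -addnA; congr (_ + _).
have [jc|jc|jc] := ltngtP j c.
- by rewrite !divn_small //; lia.
- have -> : j + (k.-1 - c) = 1 * k + (j - c.+1) by lia.
  have -> : j + (k.-1 - c).+1 = 1 * k + (j - c) by lia.
  by rewrite !divnMDl ?divn_small //; lia.
- rewrite jc.
  have -> : c + (k.-1 - c).+1 = 1 * k by lia.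
  by rewrite mulnK // divn_small //; lia.
Qed.

Lemma is_Q_exists (k r n : nat) : 0 < k -> exists Q : unif_hypergraph r n, is_Q k Q.
Proof.
move=> k0.
pose f := [ffun i : 'I_n => Ordinal (ltn_pmod i k0)].
pose E := [set e : {set 'I_n} | (#|e| == r) &
                                [forall c : 'I_k, ~~ (e \subset vclass f c)]]%SET.
have uE : [forall e in E, #|e| == r].
  by apply/forall_inP => e; rewrite inE => /andP[].
exists (UnifHypergraph uE), f; split=> // c.
have -> : #|vclass f c| = (n + (k.-1 - c)) %/ k.
  rewrite -(sum_modn_eq n (ltn_ord c)) -sum1_card big_mkcond /=.
  by apply: eq_bigr => i _; rewrite inE ffunE -val_eqE /=; case: eqP.
have jk := ltn_pmod n k0; have := divn_eq n k; have ck := ltn_ord c.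
move: jk; set j := n %% k; set q := n %/ k => jk ->.
rewrite -!addnA !divnMDl //.
have [jc|jc] := leqP j c.
  by left; rewrite divn_small ?addn0 //; lia.
right; congr (_ + _).
have -> : j + (k.-1 - c) = 1 * k + (j - c.+1) by lia.
have -> : j + k.-1 = 1 * k + j.-1 by lia.
by rewrite !divnMDl ?divn_small //; lia.
Qed.

Local Open Scope classical_set_scope.
Local Open Scope ring_scope.

Definition polyform (R : realType) (r n : nat) (G : unif_hypergraph r n) (x : 'rV[R]_n) : R :=
  r`!%:R * \sum_(e : {set 'I_n} | e \in edges G) \prod_(i in e) x 0 i.

Definition lp_sphere (R : realType) (n : nat) (p : R) : set 'rV[R]_n :=
  [set x | \sum_(i < n) `|x 0 i| `^ p = 1].
Arguments lp_sphere {R} n p.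

(* For 0 < n and 1 <= p this supremum is a maximum: see p_spectral_radius_max. *)
Definition p_spectral_radius (R : realType) (r n : nat) (p : R) (G : unif_hypergraph r n) : R :=
  sup [set polyform G x | x in lp_sphere n p].

Lemma continuous_norm_powR (R : realType) (p : R) :
  1 <= p -> continuous (fun t : R => `|t| `^ p).
Proof.
move=> p1 t; have p0 : 0 < p by apply: lt_le_trans p1.
have [->|t0] := eqVneq t 0.
  rewrite /continuous_at normr0 powR0 ?gt_eqF//.
  apply: (@squeeze_cvgr _ _ _ _ (fun=> 0) (fun t : R => `|t|)); last 2 first.
  - exact: cvg_cst.
  - by have := @norm_continuous _ R 0; rewrite /continuous_at normr0.
  near=> x; rewrite powR_ge0 /=.
  have [->|x0] := eqVneq x 0; first by rewrite normr0 powR0 ?gt_eqF.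
  apply: ge1r_powR => //; rewrite normr_gt0 x0 /=.
  near: x.
  have /cvgr_dist_lt/(_ 1 ltr01) := @cvg_id _ (nbhs (0 : R)).
  by apply: filterS => y; rewrite sub0r normrN => /ltW.
apply: (@continuous_comp _ _ _ (fun u : R => `|u|) (fun u => u `^ p)).
  exact: norm_continuous.
apply: differentiable_continuous; apply/derivable1_diffP.
by apply: derivable_powR; rewrite in_itv /= normr_gt0 t0.
Unshelve. all: by end_near.
Qed.

Lemma lp_sphere_compact (R : realType) (n : nat) (p : R) :
  1 <= p -> compact (lp_sphere n p).
Proof.
move=> p1; have p0 : 0 < p by apply: lt_le_trans p1.
apply: bounded_closed_compact.
  exists 1; split=> // M M1 x /= xS.
  rewrite (le_trans _ (ltW M1)) //.
  rewrite /Num.norm/= mx_normrE; apply: bigmax_le => //= -[a i] _ /=.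
  rewrite (ord1 a) leNgt; apply/negP => x1.
  have : 1 < \sum_(i < n) `|x 0 i| `^ p.
    rewrite (bigD1 i) //= -[X in X < _]addr0 ltr_leD //.
      have := @gt0_ltr_powR R p p0 1 `|x 0 i|.
      by rewrite powR1; apply=> //; rewrite ?inE ?nnegrE.
    by apply: sumr_ge0 => j _; exact: powR_ge0.
  by rewrite xS ltxx.
have -> : lp_sphere n p =
    (fun x : 'rV[R]_n => \sum_(i < n) `|x 0 i| `^ p) @^-1` [set 1] by [].
apply: preimage_closed; last exact: closed_eq.
move=> x _; apply: (@cvg_big _ _ _ _ _ _ _ (nbhs x)) => [|i _]; first exact: add_continuous.
apply: (@continuous_comp _ _ _ (fun x : 'rV[R]_n => x 0 i) (fun t : R => `|t| `^ p)).
  exact: coord_continuous.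
exact: continuous_norm_powR.
Qed.

Lemma p_spectral_radius_max (R : realType) (r n : nat) (p : R) (G : unif_hypergraph r n) :
  (0 < n)%N -> 1 <= p ->
  (exists2 x, lp_sphere n p x & polyform G x = p_spectral_radius p G) /\
  (forall x, lp_sphere n p x -> polyform G x <= p_spectral_radius p G).
Proof.
move=> n0 p1; have p0 : 0 < p by apply: lt_le_trans p1.
have S0 : lp_sphere n p !=set0.
  exists (delta_mx 0 (Ordinal n0)); rewrite /lp_sphere /= (bigD1 (Ordinal n0)) //=.
  rewrite mxE !eqxx normr1 powR1 big1 ?addr0 // => i /negPf i0.
  by rewrite mxE i0 andbF normr0 powR0 ?gt_eqF.
have cG : continuous (@polyform R r n G).
  move=> x; apply: (@cvgM _ _ (nbhs x) _ (fun=> _) _ _ _ (cvg_cst _)).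
  apply: (@cvg_big _ _ _ _ _ _ _ (nbhs x)) => [|e _]; first exact: add_continuous.
  apply: (@cvg_big _ _ _ _ _ _ _ (nbhs x)) => [|i _]; first exact: mul_continuous.
  exact: coord_continuous.
have [c cS cmax] := compact_EVT_max S0 (lp_sphere_compact p1) (continuous_subspaceT cG).
have ubc : ubound [set polyform G x | x in lp_sphere n p] (polyform G c).
  by move=> _ [x xS <-]; apply: cmax; rewrite ?inE.
have cS' : lp_sphere n p c by move: cS; rewrite ?inE.
have -> : p_spectral_radius p G = polyform G c.
  apply/eqP; rewrite eq_le; apply/andP; split.
    by apply: ge_sup => //; exists (polyform G c), c.
  by apply: ub_le_sup; [exists (polyform G c)|exists c].
split; first by exists c.
by move=> x xS; apply: ubc; exists x.
Qed.

(* Main.v *)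
Require Import Defs.
From mathcomp Require Import all_boot all_order all_fingroup all_algebra.
From mathcomp Require Import ring lra zify.
From mathcomp Require Import all_classical all_reals all_analysis.
Import Order.TTheory GRing.Theory Num.Theory.
Set Implicit Arguments.
Unset Strict Implicit.
Unset Printing Implicit Defensive.
Local Open Scope ring_scope.

(* Let K_f be the complete 3-graph of a colouring f.  By Newton's identities its
   polynomial form at x depends only on the class sums s_c of x and q_c of x^2:
     P = S^3 - 3 S T - \sum_c (s_c^3 - 3 s_c q_c),  S = \sum_c s_c,  T = \sum_c q_c,
   the cubes cancelling.  Let (f, x) maximise P over all colourings and all x >= 0
   with \sum_i x_i^p <= 1.
   - Averaging two entries of one class lowers q_c and keeps s_c, so x is constant
     on each class.
   - If x_v = 0, giving v the colour of any w leaves P unchanged, and then x_v = x_w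
     by the previous point; hence x > 0.
   - If two classes have sizes N >= K + 2 with N >= 3 and values a, b, move a vertex
     from the first to the second.  If N a / (N - 1) <= K b / (K + 1), rescale so that
     both class sums are kept; otherwise put the common mean on both classes.  The new
     values lie between a and b and have the same total, so convexity controls the p-norm
     and the q_c, and P strictly increases: a contradiction.
   So f is balanced, or all classes have at most 2 elements and every triple is an
   edge; either way K_f is isomorphic to Q.  A k-chromatic G lies in some K_f;
   if its radius is not smaller, that f is optimal with a positive maximiser, which
   forces G = K_f. *)

(** * Convexity of powers and squares *)

Lemma powR_convex (R : realType) (p l a b : R) :
  1 <= p -> 0 <= l <= 1 -> 0 <= a -> 0 <= b ->
  (l * a + (1 - l) * b) `^ p <= l * a `^ p + (1 - l) * b `^ p.
Proof.
move=> p1 /andP[l0 l1] a0 b0.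
have h := @convex_powR R p p1 (Itv01 l0 l1) a b.
by rewrite !convRE /= in h; apply: h; rewrite inE/= in_itv/= ?a0 ?b0.
Qed.

Lemma sqr_convex (R : realType) (l a b : R) : 0 <= l <= 1 ->
  (l * a + (1 - l) * b) ^+ 2 <= l * a ^+ 2 + (1 - l) * b ^+ 2.
Proof.
move=> /andP[l0 l1]; rewrite -subr_ge0.
have -> : l * a ^+ 2 + (1 - l) * b ^+ 2 - (l * a + (1 - l) * b) ^+ 2 =
          l * (1 - l) * (a - b) ^+ 2 by ring.
by rewrite mulr_ge0 ?sqr_ge0 // mulr_ge0 // subr_ge0.
Qed.

(** * The third elementary symmetric function in terms of power sums *)

Section ElementarySymmetric.
Variables (R : realType) (I : finType).
Implicit Types (x : I -> R) (r : seq I).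

(** Coefficient j of [P] is the j-th elementary symmetric function, and a further factor
    [x a *: 'X + 1] adds to it [x a] times coefficient j - 1. *)
Lemma esym_Newton x r :
  let P := \prod_(i <- r) (x i *: 'X + 1) : {poly R} in
  let p j := \sum_(i <- r) x i ^+ j in
  [/\ P`_0 = 1, P`_1 = p 1%N, 2 * P`_2 = p 1%N ^+ 2 - p 2%N &
      6 * P`_3 = p 1%N ^+ 3 - 3 * p 1%N * p 2%N + 2 * p 3%N].
Proof.
elim: r => [|a r [h0 h1 h2 h3]] /=.
  by rewrite !big_nil !coef1 /=; split=> //; ring.
rewrite !big_cons mulrDl mul1r -scalerAl !coefD !coefZ !coefXM /= h0 h1.
split; [ring|ring| |].
- rewrite mulrDr h2; ring.
- rewrite !mulrDr h3.
  have -> : 6 * (x a * (\prod_(i <- r) (x i *: 'X + 1))`_2) =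
    3 * x a * (2 * (\prod_(i <- r) (x i *: 'X + 1))`_2) by ring.
  rewrite h2; ring.
Qed.

Lemma sum_prod_3sets x :
  6 * \sum_(e : {set I} | #|e| == 3) \prod_(i in e) x i =
  (\sum_i x i) ^+ 3 - 3 * (\sum_i x i) * (\sum_i x i ^+ 2) +
  2 * \sum_i x i ^+ 3.
Proof.
have [_ _ _] := esym_Newton x (index_enum I).
under [in X in _ = X -> _]eq_bigr do rewrite expr1.
move=> <-; congr (_ * _).
(* Expanding the product gives one monomial of degree [#|e|] for each set [e]; degree 3 selects the
   triples. *)
rewrite bigA_distr coef_sum big_mkcond /=.
apply: eq_bigr => e _.
rewrite -big_mkcond /=.
rewrite (eq_bigr (fun i => (x i)%:P * 'X)); last by move=> i _; rewrite mul_polyC.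
rewrite big_split /= prodr_const -rmorph_prod coefCM coefXn.
by rewrite eq_sym; case: eqP => _; rewrite ?mulr1 ?mulr0.
Qed.

End ElementarySymmetric.

(** * The real inequality for moving one vertex *)

(** Classes of sizes N, K with values a, b become classes of sizes N - 1, K + 1 with values b1, b2.
    Each side of the last inequality is one third of the form carried by the edges inside these two
    classes. By the weight equation the complementary weights add up to K, so totals of convex
    functions do not grow. *)
Lemma balancing_weights (R : realType) (N K : nat) (a b : R) :
  (K + 2 <= N)%N -> (3 <= N)%N -> 0 < a -> 0 < b ->
  exists l1 l2 : R, [/\ 0 <= l1 <= 1, 0 <= l2 <= 1,
    (N%:R - 1) * l1 + (K%:R + 1) * l2 = N%:R &
    let b1 := l1 * a + (1 - l1) * b in let b2 := l2 * a + (1 - l2) * b in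
    N%:R * K%:R * a * b * ((N%:R - 1) * a + (K%:R - 1) * b) <
    (N%:R - 1) * (K%:R + 1) * b1 * b2 * ((N%:R - 2) * b1 + K%:R * b2)].
Proof.
move=> NK N3 a0 b0.
have NK' : K%:R + 2 <= N%:R :> R by rewrite -natrD ler_nat.
have N3' : 3 <= N%:R :> R by rewrite ler_nat.
have [K0|K1] := leqP K 0.
  (* With K = 0 the left side vanishes, and the value a is kept everywhere. *)
  have -> : K = 0%N by lia.
  exists 1, 1; rewrite /= !ler01 !lexx; split=> //; first by ring.
  rewrite mulr0 !mul0r !mul1r subrr mul0r !addr0 add0r mulr1.
  have n1 : 0 < N%:R - 1 :> R by lra.
  have n2 : 0 < N%:R - 2 :> R by lra.
  by rewrite !mulr_gt0.
have K1' : 1 <= K%:R :> R by rewrite ler1n.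
move: (N%:R) (K%:R) NK' N3' K1' => n k {NK N3 K1 N K} nk n3 k1.
have [cA|cB] := leP (n * a * (k + 1)) (k * b * (n - 1)).
- have ab : 0 < b - a.
    have na0 : 0 < n * a by rewrite mulr_gt0 //; lra.
    have kb0 : 0 < k * b by rewrite mulr_gt0 //; lra.
    have : 0 < n * k * (b - a) by lra.
    by rewrite pmulr_rgt0 // mulr_gt0 //; lra.
  have n1 : 0 < n - 1 by lra.
  have k1p : 0 < k + 1 by lra.
  (* These weights give b1 = n a / (n - 1) and b2 = k b / (k + 1). Both class sums stay fixed, and
     only b1 + b2 < a + b remains to be shown. *)
  exists (1 - a / ((n - 1) * (b - a))), (b / ((k + 1) * (b - a))).
  have p1 : 0 < (n - 1) * (b - a) by rewrite mulr_gt0.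
  have p2 : 0 < (k + 1) * (b - a) by rewrite mulr_gt0.
  have ab2 : n * k * (b - a) >= n * a + k * b by lra.
  have q1 : a / ((n - 1) * (b - a)) <= 1 by rewrite ler_pdivrMr //; nra.
  have q2 : b / ((k + 1) * (b - a)) <= 1 by rewrite ler_pdivrMr //; nra.
  have q3 : 0 < a / ((n - 1) * (b - a)) by rewrite divr_gt0.
  have q4 : 0 < b / ((k + 1) * (b - a)) by rewrite divr_gt0.
  have nz1 : n - 1 != 0 by rewrite gt_eqF.
  have nz2 : k + 1 != 0 by rewrite gt_eqF.
  have nz3 : b - a != 0 by rewrite gt_eqF.
  split.
  + by apply/andP; split; lra.
  + by apply/andP; split; lra.
  + by field; rewrite nz1 nz2 nz3.
  + move=> b1 b2.
    have eb1 : (n - 1) * b1 = n * a by rewrite /b1; field; rewrite nz1 nz3.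
    have eb2 : (k + 1) * b2 = k * b by rewrite /b2; field; rewrite nz2 nz3.
    have -> : (n - 1) * (k + 1) * b1 * b2 = n * k * a * b.
      by transitivity (((n - 1) * b1) * ((k + 1) * b2)); [ring|rewrite eb1 eb2; ring].
    rewrite ltr_pM2l; last by rewrite !mulr_gt0 //; lra.
    have -> : (n - 2) * b1 + k * b2 = (n - 1) * b1 + (k + 1) * b2 - b1 - b2 by ring.
    rewrite eb1 eb2.
    have b1E : b1 = a + a / (n - 1) by rewrite /b1; field; rewrite nz1 nz3.
    have b2E : b2 = b - b / (k + 1) by rewrite /b2; field; rewrite nz2 nz3.
    have : a / (n - 1) < b / (k + 1).
      rewrite ltr_pdivrMr // mulrAC ltr_pdivlMr //; nra.
    by rewrite b1E b2E; lra.
- have m0 : 0 < n + k by lra.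
  have nz : n + k != 0 by rewrite gt_eqF.
  (* Equal weights put the common mean c on both classes; z measures the deviation from it, as a = c
     - k z and b = c + n z. *)
  exists (n / (n + k)), (n / (n + k)).
  split.
  + by rewrite divr_ge0 ?ler_pdivrMr //; lra.
  + by rewrite divr_ge0 ?ler_pdivrMr //; lra.
  + by field.
  + cbv zeta; set c := n / (n + k) * a + (1 - n / (n + k)) * b.
    set z := (b - a) / (n + k).
    have aE : a = c - k * z by rewrite /c /z; field.
    have bE : b = c + n * z by rewrite /c /z; field.
    have c0 : 0 < c.
      have cE : (n + k) * c = n * a + k * b by rewrite /c; field.
      have : 0 < (n + k) * c by rewrite cE addr_gt0 ?mulr_gt0 //; lra.
      by rewrite pmulr_rgt0.
    have c0' : 0 < (n + k - 2) * c by rewrite mulr_gt0 //; lra.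
    have -> : (n - 2) * c + k * c = (n + k - 2) * c by ring.
    have -> : (n - 1) * a + (k - 1) * b = (n + k - 2) * c - (n - k) * z.
      by rewrite aE bE; ring.
    have [z0|z0] := leP 0 z.
    (* Up to the factor n + k, this is the failure of the first case. *)
    * have y0 : 0 < c - n * k * z.
        have : 0 < (n + k) * (c - n * k * z); last by rewrite pmulr_rgt0.
        rewrite -subr_gt0 in cB; move: cB.
        by congr (0 < _); rewrite aE bE; ring.
      have lt1 : n * k * a * b < (n - 1) * (k + 1) * c * c.
        rewrite -subr_gt0.
        have -> : (n - 1) * (k + 1) * c * c - n * k * a * b =
          (c - n * k * z) * c * (n - k - 2) + (c - n * k * z) ^+ 2.
          by rewrite aE bE; ring.
        have nk2 : 0 <= n - k - 2 by lra.
        by rewrite ltr_wpDl ?exprn_gt0 // mulr_ge0 // ltW // mulr_gt0.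
      have f0 : 0 < n * k * a * b by rewrite !mulr_gt0 //; lra.
      have le1 : (n + k - 2) * c - (n - k) * z <= (n + k - 2) * c.
        by rewrite gerBl mulr_ge0 //; lra.
      apply: le_lt_trans (_ : _ <= n * k * a * b * ((n + k - 2) * c)) _.
        by rewrite ler_pM2l.
      by rewrite ltr_pM2r.
    (* Here a > b. The linear factor exceeds its value at the mean by w, but a b lies below c^2 by
       at least w c, which outweighs this. The strict gain comes from n k < (n - 1) (k + 1). *)
    * pose w := - ((n - k) * z).
      have w0 : 0 < w by rewrite /w -mulrN mulr_gt0 //; lra.
      have -> : (n + k - 2) * c - (n - k) * z = (n + k - 2) * c + w by [].
      have ab0 : 0 < a * b by rewrite mulr_gt0.
      have abE : a * b = c ^+ 2 - w * c - n * k * z ^+ 2.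
        by rewrite /w aE bE; ring.
      have nk0 : 0 < n * k by rewrite mulr_gt0 //; lra.
      have abw : a * b <= c ^+ 2 - w * c.
        by rewrite abE gerBl mulr_ge0 ?sqr_ge0 // ltW.
      have h1 : a * b * ((n + k - 2) * c + w) <= (n + k - 2) * c ^+ 3.
        apply: le_trans (_ : (c ^+ 2 - w * c) * ((n + k - 2) * c + w) <= _).
          by rewrite ler_pM2r // addr_gt0.
        rewrite -subr_ge0.
        have -> : (n + k - 2) * c ^+ 3 - (c ^+ 2 - w * c) * ((n + k - 2) * c + w) =
          w * c * ((n + k - 3) * c + w) by ring.
        have nk3 : 0 <= n + k - 3 by lra.
        by rewrite mulr_ge0 // ?addr_ge0 ?mulr_ge0 // ltW // mulr_gt0.
      apply: le_lt_trans (_ : _ <= n * k * ((n + k - 2) * c ^+ 3)) _.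
        by rewrite -(mulrA (n * k) a b) -(mulrA (n * k)) ler_pM2l.
      rewrite -subr_gt0.
      have -> : (n - 1) * (k + 1) * c * c * ((n + k - 2) * c) -
        n * k * ((n + k - 2) * c ^+ 3) = (n - k - 1) * ((n + k - 2) * c) * c ^+ 2.
        by ring.
      by rewrite mulr_gt0 ?exprn_gt0 // mulr_gt0 //; lra.
Qed.

(** * The form of a complete graph through class sums *)

Definition complete_edges (k r n : nat) (f : {ffun 'I_n -> 'I_k}) : {set {set 'I_n}} :=
  [set e : {set 'I_n} | (#|e| == r) & [forall c : 'I_k, ~~ (e \subset vclass f c)]].

Lemma complete_edges_uniform (k r n : nat) (f : {ffun 'I_n -> 'I_k}) :
  [forall e in complete_edges r f, #|e| == r].
Proof. by apply/forall_inP => e; rewrite inE => /andP[]. Qed.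

Definition complete_graph (k r n : nat) (f : {ffun 'I_n -> 'I_k}) : unif_hypergraph r n :=
  UnifHypergraph (complete_edges_uniform r f).

Definition class_form (R : realType) (k : nat) (s q : 'I_k -> R) : R :=
  (\sum_c s c) ^+ 3 - 3 * (\sum_c s c) * (\sum_c q c)
  - \sum_c (s c ^+ 3 - 3 * s c * q c).

Definition class_sum (R : realType) (k n : nat) (f : {ffun 'I_n -> 'I_k})
  (x : 'I_n -> R) (c : 'I_k) : R := \sum_(i | f i == c) x i.

Definition complete_form (R : realType) (k n : nat) (f : {ffun 'I_n -> 'I_k})
  (x : 'I_n -> R) : R :=
  class_form (class_sum f x) (class_sum f (fun i => x i ^+ 2)).

Section CompleteForm.
Variables (R : realType) (k n : nat).
Implicit Types (f : {ffun 'I_n -> 'I_k}) (x y : 'I_n -> R).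

Lemma sum_class_sum f x : \sum_c class_sum f x c = \sum_i x i.
Proof. by rewrite (partition_big f predT). Qed.

Lemma polyform_complete f x :
  polyform (complete_graph 3 f) (\row_i x i) = complete_form f x.
Proof.
rewrite /polyform /= (_ : 3`! = 6)%N //.
(* A triple is a non-edge exactly when it lies in one class, and then in only one. Cutting [x] to
   zero outside class [c] keeps just the products over triples inside [c]. *)
have -> : \sum_(e in complete_edges 3 f) \prod_(i in e) (\row_i x i) 0 i =
   \sum_(e : {set 'I_n} | #|e| == 3) \prod_(i in e) x i -
   \sum_c \sum_(e : {set 'I_n} | #|e| == 3) \prod_(i in e) (x i *+ (f i == c)).
  rewrite exchange_big /= -sumrB big_mkcond [RHS]big_mkcond /=.
  apply: eq_bigr => e _; rewrite inE.
  case: ifP => [/andP[e3 /forallP fe]|].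
    rewrite e3 /= [X in _ - X]big1 ?subr0 => [|c _].
      by apply: eq_bigr => i _; rewrite mxE.
    have /subsetPn[i ie] := fe c.
    by rewrite inE => ic; rewrite (bigD1 i) //= (negPf ic) mulr0n mul0r.
  case: ifP => //= e3 /negbT/forallPn[c /negPn/fintype.subsetP ec].
  have fc i : i \in e -> f i = c by move=> /ec; rewrite inE => /eqP.
  rewrite (bigD1 c) //= [X in _ - (_ + X)]big1 ?addr0 => [|d dc].
    rewrite -[LHS](subrr (\prod_(i in e) x i)); congr (_ - _).
    by apply: eq_bigr => i /fc ->; rewrite eqxx.
  have /card_gt0P[i ie] : (0 < #|e|)%N by rewrite (eqP e3).
  by rewrite (bigD1 i) //= (fc _ ie) eq_sym (negPf dc) mulr0n mul0r.
rewrite mulrBr sum_prod_3sets [X in _ - X]mulr_sumr.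
under [X in _ - X]eq_bigr do rewrite sum_prod_3sets.
have cl (F : R -> R) c : F 0 = 0 ->
    \sum_i F (x i *+ (f i == c)) = \sum_(i | f i == c) F (x i).
  move=> F0; rewrite [RHS]big_mkcond; apply: eq_bigr => i _.
  by case: eqP.
have E c : (\sum_i x i *+ (f i == c)) ^+ 3 -
     3 * (\sum_i x i *+ (f i == c)) * (\sum_i (x i *+ (f i == c)) ^+ 2) +
     2 * (\sum_i (x i *+ (f i == c)) ^+ 3) =
   (class_sum f x c ^+ 3 - 3 * class_sum f x c * class_sum f (fun i => x i ^+ 2) c)
    + 2 * class_sum f (fun i => x i ^+ 3) c.
  rewrite (cl id) // (cl (fun t => t ^+ 2)) ?expr0n //.
  by rewrite (cl (fun t => t ^+ 3)) ?expr0n.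
rewrite (eq_bigr _ (fun c _ => E c)) big_split /= -mulr_sumr.
rewrite /complete_form /class_form !sum_class_sum.
by ring.
Qed.

(** The form is affine in [q], with coefficient -3 (S - s_c) at [q c]: smaller squares in one class
    pay off as soon as the other classes have positive sum. *)
Lemma class_form_decr (s q q' : 'I_k -> R) (c : 'I_k) :
  (forall d, d != c -> q' d = q d) ->
  class_form s q' - class_form s q = 3 * (\sum_d s d - s c) * (q c - q' c).
Proof.
move=> E; rewrite /class_form.
rewrite (bigD1 c (F := q')) //= (bigD1 c (F := q)) //=.
rewrite (bigD1 c (F := fun d => s d ^+ 3 - 3 * s d * q' d)) //=.
rewrite (bigD1 c (F := fun d => s d ^+ 3 - 3 * s d * q d)) //=.
have E2 d : d != c -> s d ^+ 3 - 3 * s d * q' d = s d ^+ 3 - 3 * s d * q d.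
  by move=> /E->.
rewrite (eq_bigr _ E) (eq_bigr _ E2).
by ring.
Qed.

(** No edge lies inside one class. This serves to show that a positive form needs weight in two
    classes. *)
Lemma class_form_single (s q : 'I_k -> R) (c : 'I_k) :
  (forall d, d != c -> s d = 0 /\ q d = 0) -> class_form s q = 0.
Proof.
move=> E; rewrite /class_form !(bigD1 c (P := predT)) //= !big1.
- by ring.
- by move=> d /E[-> ->]; ring.
- by move=> d /E[].
- by move=> d /E[].
Qed.

End CompleteForm.

(** * Maximal pairs of a colouring and a vector *)

Lemma sum_update2 (R : realType) (I : finType) (x : I -> R) (v w : I) (t : R)
    (P : pred I) (F : R -> R) : v != w ->
  \sum_(i | P i) F (if (i == v) || (i == w) then t else x i) =
  \sum_(i | P i) F (x i) + (F t - F (x v)) *+ P v + (F t - F (x w)) *+ P w.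
Proof.
move=> vw; apply/eqP; rewrite -addrA addrC -subr_eq -sumrB big_mkcond /=.
rewrite (bigD1 v) //= (bigD1 w) 1?eq_sym //= !eqxx orbT /= big1 ?addr0.
  by case: (P v); case: (P w).
by move=> i /andP[/negPf-> /negPf->] /=; rewrite subrr if_same.
Qed.

(** A ball is taken rather than the sphere, so that averaging, which may lower the p-norm, calls for
    no rescaling. *)
Definition lp_admissible (R : realType) (n : nat) (p : R) (x : 'I_n -> R) : Prop :=
  (forall i, 0 <= x i) /\ \sum_i x i `^ p <= 1.

Definition maximal_pair (R : realType) (k n : nat) (p : R)
    (f : {ffun 'I_n -> 'I_k}) (x : 'I_n -> R) : Prop :=
  [/\ lp_admissible p x, 0 < complete_form f x &
      forall (f' : {ffun 'I_n -> 'I_k}) (y : 'I_n -> R), lp_admissible p y ->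
        complete_form f' y <= complete_form f x].

Section MaximalPair.
Variables (R : realType) (k n : nat) (p : R).
Hypothesis p1 : 1 <= p.
Implicit Types (f : {ffun 'I_n -> 'I_k}) (x y : 'I_n -> R).

Lemma class_sum_lt f x (c : 'I_k) : (forall i, 0 <= x i) -> 0 < complete_form f x ->
  class_sum f x c < \sum_d class_sum f x d.
Proof.
move=> x0 F0; rewrite ltNge; apply/negP => le.
have s0 d : 0 <= class_sum f x d by apply: sumr_ge0.
have z : \sum_(d | d != c) class_sum f x d = 0.
  apply/eqP; rewrite eq_le sumr_ge0 // andbT.
  by move: le; rewrite (bigD1 c) //= gerDl.
move: F0; rewrite /complete_form (class_form_single (c := c)) ?ltxx // => d dc.
have sd : class_sum f x d = 0.
  by move/eqP: z; rewrite psumr_eq0 // => /allP/(_ d (mem_index_enum _)) /implyP/(_ dc)/eqP.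
split=> //; apply: big1 => i fi; move/eqP: sd; rewrite psumr_eq0 //.
by move=> /allP/(_ i (mem_index_enum _)) /implyP/(_ fi)/eqP->; rewrite expr0n.
Qed.

(** Averaging the two entries keeps the class sums and, by convexity, does not raise the p-norm. The
    strict gain comes from the squares, hence p = 1 is covered. *)
Lemma maximal_pair_constant f x (v w : 'I_n) :
  maximal_pair p f x -> f v = f w -> x v = x w.
Proof.
move=> [[x0 xp] F0 M] fvw; apply/eqP/negPn/negP => xvw.
have vw : v != w by apply: contraNneq xvw => ->.
pose t := (x v + x w) / 2.
pose y i := if (i == v) || (i == w) then t else x i.
have y0 i : 0 <= y i by rewrite /y; case: ifP => // _; rewrite divr_ge0 ?addr_ge0.
have half : 0 <= (2^-1 : R) <= 1 by rewrite invr_ge0 ler0n invf_le1 ?ler1n.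
have tE : t = 2^-1 * x v + (1 - 2^-1) * x w by rewrite /t; field.
have ay : lp_admissible p y.
  split=> //; apply: le_trans xp.
  rewrite (sum_update2 x t xpredT (fun u => u `^ p) vw) /= -addrA gerDl.
  have := @powR_convex _ _ _ _ _ p1 half (x0 v) (x0 w).
  by rewrite -tE => h; lra.
have := M f y ay; apply/negP; rewrite -ltNge -subr_gt0 /complete_form.
have sE : class_sum f y = class_sum f x.
  apply/funext => c; rewrite /class_sum (sum_update2 x t _ id vw) /= fvw.
  case: eqP => _; rewrite ?mulr0n ?mulr1n ?addr0 // -addrA.
  by rewrite /t; lra.
have qE c : class_sum f (fun i => y i ^+ 2) c =
    class_sum f (fun i => x i ^+ 2) c + (2 * t ^+ 2 - x v ^+ 2 - x w ^+ 2) *+ (f w == c).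
  rewrite /class_sum (sum_update2 x t _ (fun u => u ^+ 2) vw) /= fvw.
  by case: eqP => _; rewrite ?mulr0n ?mulr1n ?addr0 //; ring.
rewrite sE (class_form_decr _ (c := f w)) => [|d dw]; last first.
  by rewrite qE eq_sym (negPf dw) mulr0n addr0.
rewrite qE eqxx mulr1n.
have := class_sum_lt (f w) x0 F0 => lt.
apply: mulr_gt0; first by rewrite mulr_gt0 // subr_gt0.
have -> : class_sum f (fun i => x i ^+ 2) (f w) -
   (class_sum f (fun i => x i ^+ 2) (f w) + (2 * t ^+ 2 - x v ^+ 2 - x w ^+ 2)) =
   (x v - x w) ^+ 2 / 2 by rewrite /t; field.
by rewrite divr_gt0 // exprn_even_gt0 //= subr_eq0.
Qed.

Lemma maximal_pair_pos f x (v : 'I_n) : maximal_pair p f x -> 0 < x v.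
Proof.
move=> [[x0 xp] F0 M]; rewrite lt0r x0 andbT; apply/eqP => xv.
have [w xw] : exists w, 0 < x w.
  apply/not_existsP => h; have x00 i : x i = 0.
    by apply/eqP; rewrite eq_le x0 leNgt andbT; apply/negP/h.
  move: F0; rewrite /complete_form (class_form_single (c := f v)) ?ltxx // => d _.
  by split; apply: big1 => i _; rewrite x00 ?expr0n.
(* The colour of a vertex of value 0 affects no class sum, so [v] may join the class of [w]. *)
pose f' := [ffun i => if i == v then f w else f i].
have E (F : R -> R) : F 0 = 0 ->
    class_sum f' (fun i => F (x i)) = class_sum f (fun i => F (x i)).
  move=> F00; apply/funext => c; rewrite /class_sum big_mkcond [RHS]big_mkcond /=.
  apply: eq_bigr => i _; rewrite ffunE; case: (eqVneq i v) => // ->.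
  by rewrite xv F00 !if_same.
have FE : complete_form f' x = complete_form f x.
  rewrite /complete_form (E (fun t => t ^+ 2)) ?expr0n //.
  by have /= -> := E id erefl.
have mp : maximal_pair p f' x.
  by split=> //; rewrite FE // => g y; exact: M.
have := maximal_pair_constant (v := v) (w := w) mp.
rewrite !ffunE eqxx if_same => /(_ erefl) e.
by rewrite -e xv ltxx in xw.
Qed.

End MaximalPair.

(** * Moving a vertex between two classes *)

Lemma sum_split2 (R : realType) (I : finType) (c d : I) (F : I -> R) : c != d ->
  \sum_e F e = F c + F d + \sum_(e | (e != c) && (e != d)) F e.
Proof. by move=> cd; rewrite (bigD1 c) //= (bigD1 d) 1?eq_sym //= addrA. Qed.

(** The first term is the interaction with the other classes, which notice only the squares because
    the joint sum is kept. The second is the change of the form of the two classes taken alone. *)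
Lemma class_form_move (R : realType) (k : nat) (s q s' q' : 'I_k -> R) (c d : 'I_k) :
  c != d -> (forall e, e != c -> e != d -> s' e = s e /\ q' e = q e) ->
  s' c + s' d = s c + s d ->
  class_form s' q' - class_form s q =
  3 * (\sum_(e | (e != c) && (e != d)) s e) * (q c + q d - q' c - q' d) +
  3 * ((s c + s d) * s' c * s' d - s' d * q' c - s' c * q' d -
       ((s c + s d) * s c * s d - s d * q c - s c * q d)).
Proof.
move=> cd E sE; rewrite /class_form !(sum_split2 _ cd).
have Es e : (e != c) && (e != d) -> s' e = s e by move=> /andP[h1 h2]; case: (E e h1 h2).
have Eq e : (e != c) && (e != d) -> q' e = q e by move=> /andP[h1 h2]; case: (E e h1 h2).
have Et e : (e != c) && (e != d) ->
    s' e ^+ 3 - 3 * s' e * q' e = s e ^+ 3 - 3 * s e * q e.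
  by move=> h; rewrite Es ?Eq.
rewrite (eq_bigr _ Es) (eq_bigr _ Eq) (eq_bigr _ Et).
have -> : s' d = s c + s d - s' c by rewrite -sE addrC addKr.
by ring.
Qed.

Section Balance.
Variables (R : realType) (k n : nat) (p : R).
Hypothesis p1 : 1 <= p.
Implicit Types (f : {ffun 'I_n -> 'I_k}) (x y : 'I_n -> R).

Lemma class_sum_const f x (c : 'I_k) (t : R) :
  (forall i, f i = c -> x i = t) -> class_sum f x c = #|vclass f c|%:R * t.
Proof.
move=> h; rewrite /class_sum (eq_bigr (fun=> t)) => [|i /eqP/h //].
rewrite sumr_const mulr_natl; congr (_ *+ _).
by apply: eq_card => i; rewrite !inE.
Qed.

Lemma maximal_pair_balanced f x (c d : 'I_k) : maximal_pair p f x ->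
  (3 <= #|vclass f c|)%N -> (#|vclass f c| <= #|vclass f d| + 1)%N.
Proof.
move=> mp N3; rewrite leqNgt; apply/negP; rewrite addn1 => NK.
have [[x0 xp] F0 M] := mp.
have cd : c != d by apply: contraTneq NK => ->; rewrite -leqNgt ltnW.
have /card_gt0P[w] : (0 < #|vclass f c|)%N by apply: leq_trans N3.
rewrite inE => /eqP fw.
pose a := x w; have a0 : 0 < a by exact: (maximal_pair_pos p1 _ mp).
have xa i : f i = c -> x i = a.
  by move=> fi; apply: (maximal_pair_constant p1 mp); rewrite fi.
have [b b0 xb] : exists2 b, 0 < b & forall i, f i = d -> x i = b.
  have [/eqP K0|/card_gt0P[u]] := posnP #|vclass f d|.
    (* An empty class [d] has no value to read off; any positive [b] will do. *)
    exists a => // i fi; move: K0; rewrite cards_eq0 => /eqP/setP/(_ i).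
    by rewrite !inE fi eqxx.
  rewrite inE => /eqP fu; exists (x u) => [|i fi]; first exact: (maximal_pair_pos p1 _ mp).
  by apply: (maximal_pair_constant p1 mp); rewrite fi.
have NK' : (#|vclass f d| + 2 <= #|vclass f c|)%N by rewrite addn2.
have [l1 [l2 [l101 l201 lE]]] := balancing_weights NK' N3 a0 b0.
have /andP[l10 l11] := l101; have /andP[l20 l21] := l201.
set b1 := l1 * a + (1 - l1) * b; set b2 := l2 * a + (1 - l2) * b => /= lt3.
have b10 : 0 <= b1 by rewrite addr_ge0 ?mulr_ge0 ?subr_ge0 // ltW.
have b20 : 0 <= b2 by rewrite addr_ge0 ?mulr_ge0 ?subr_ge0 // ltW.
pose f' := [ffun i => if i == w then d else f i].
pose y i := if f' i == c then b1 else if f' i == d then b2 else x i.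
have Nc : #|vclass f' c|%:R = #|vclass f c|%:R - 1 :> R.
  rewrite [in RHS](cardsD1 w) inE fw eqxx natrD addrAC subrr add0r; congr (_%:R).
  apply: eq_card => i; rewrite !inE ffunE.
  by case: (eqVneq i w) => //= _; rewrite [d == c]eq_sym (negPf cd).
have Nd : #|vclass f' d|%:R = #|vclass f d|%:R + 1 :> R.
  have -> : vclass f' d = w |: vclass f d.
    by apply/setP => i; rewrite !inE ffunE; case: (eqVneq i w) => //=; rewrite eqxx.
  by rewrite cardsU1 inE fw cd natrD addrC.
have yc (F : R -> R) : class_sum f' (fun i => F (y i)) c = (#|vclass f c|%:R - 1) * F b1.
  by rewrite -Nc; apply: class_sum_const => i fi; rewrite /y fi eqxx.
have yd (F : R -> R) : class_sum f' (fun i => F (y i)) d = (#|vclass f d|%:R + 1) * F b2.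
  rewrite -Nd; apply: class_sum_const => i fi.
  by rewrite /y fi eq_sym (negPf cd) eqxx.
have xc (F : R -> R) : class_sum f (fun i => F (x i)) c = #|vclass f c|%:R * F a.
  by apply: class_sum_const => i /xa->.
have xd (F : R -> R) : class_sum f (fun i => F (x i)) d = #|vclass f d|%:R * F b.
  by apply: class_sum_const => i /xb->.
have ye (F : R -> R) e : e != c -> e != d ->
    class_sum f' (fun i => F (y i)) e = class_sum f (fun i => F (x i)) e.
  move=> ec ed; rewrite /class_sum; apply: eq_big => i.
    by rewrite ffunE; case: (eqVneq i w) => // ->; rewrite fw ![_ == e]eq_sym (negPf ed) (negPf ec).
  by move=> /eqP fi; rewrite /y fi (negPf ec) (negPf ed).
(* By [lE] the weights on [A] add up to the old size of [c], and those on [B] to that of [d]. This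
   serves both the p-th powers and the squares. *)
have convex_sum (A B A1 B1 : R) : A1 <= l1 * A + (1 - l1) * B ->
    B1 <= l2 * A + (1 - l2) * B ->
    (#|vclass f c|%:R - 1) * A1 + (#|vclass f d|%:R + 1) * B1 <=
    #|vclass f c|%:R * A + #|vclass f d|%:R * B.
  move=> h1 h2.
  have -> : #|vclass f c|%:R * A + #|vclass f d|%:R * B =
    (#|vclass f c|%:R - 1) * (l1 * A + (1 - l1) * B) +
    (#|vclass f d|%:R + 1) * (l2 * A + (1 - l2) * B).
    transitivity (((#|vclass f c|%:R - 1) * l1 + (#|vclass f d|%:R + 1) * l2) * A +
      (#|vclass f c|%:R + #|vclass f d|%:R
       - ((#|vclass f c|%:R - 1) * l1 + (#|vclass f d|%:R + 1) * l2)) * B).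
      by rewrite lE; ring.
    by ring.
  by apply: lerD; apply: ler_wpM2l => //; rewrite ?subr_ge0 ?ler1n ?addr_ge0 // (leq_trans _ N3).
have ay : lp_admissible p y.
  split=> [i|]; first by rewrite /y; case: ifP => // _; case: ifP.
  apply: le_trans xp.
  rewrite -(sum_class_sum f') -(sum_class_sum f) !(sum_split2 _ cd).
  rewrite (yc (fun t => t `^ p)) (yd (fun t => t `^ p)).
  rewrite (xc (fun t => t `^ p)) (xd (fun t => t `^ p)).
  apply: lerD.
    by apply: convex_sum; apply: powR_convex => //; exact: ltW.
  rewrite le_eqVlt; apply/orP; left; apply/eqP; apply: eq_bigr => e /andP[ec ed].
  exact: (ye (fun t => t `^ p)).
have := M f' y ay; apply/negP; rewrite -ltNge -subr_gt0 /complete_form.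
have ss : class_sum f' y c + class_sum f' y d = class_sum f x c + class_sum f x d.
  rewrite (yc id) (yd id) (xc id) (xd id) /= /b1 /b2.
  transitivity (((#|vclass f c|%:R - 1) * l1 + (#|vclass f d|%:R + 1) * l2) * a +
      (#|vclass f c|%:R + #|vclass f d|%:R
       - ((#|vclass f c|%:R - 1) * l1 + (#|vclass f d|%:R + 1) * l2)) * b).
    by ring.
  by rewrite lE; ring.
rewrite (class_form_move cd _ ss) => [|e ec ed]; last first.
  by rewrite (ye id) // (ye (fun t => t ^+ 2)).
rewrite -ss (yc id) (yd id) (yc (fun t => t ^+ 2)) (yd (fun t => t ^+ 2)).
have ss' : (#|vclass f c|%:R - 1) * b1 + (#|vclass f d|%:R + 1) * b2 =
    #|vclass f c|%:R * a + #|vclass f d|%:R * b.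
  by have := ss; rewrite (yc id) (yd id) (xc id) (xd id).
rewrite (xc id) (xd id) (xc (fun t => t ^+ 2)) (xd (fun t => t ^+ 2)) /=.
(* The squares of the two classes do not grow in total, so the first term is nonnegative; positivity
   of the second is [lt3] after expansion. *)
apply: ltr_wpDl.
  rewrite mulr_ge0 // ?mulr_ge0 ?sumr_ge0 // => [e _|]; first by rewrite /class_sum sumr_ge0.
  by rewrite -addrA -opprD subr_ge0; apply: convex_sum; apply: sqr_convex.
rewrite mulr_gt0 // subr_gt0.
apply: le_lt_trans (lt_le_trans lt3 _); rewrite le_eqVlt; apply/orP; left; apply/eqP.
  by rewrite ss'; ring.
by ring.
Qed.

End Balance.

(** * Isomorphism of balanced colourings *)

(** Equal fibre sizes mean that the two tuples of values agree up to order. *)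
Lemma fiber_perm (n : nat) (C : eqType) (F G : 'I_n -> C) :
  (forall c, #|[set i | F i == c]| = #|[set i | G i == c]|) ->
  exists s : {perm 'I_n}, forall i, G (s i) = F i.
Proof.
move=> h.
have /tuple_permP[s sE] : perm_eq [tuple F i | i < n] [tuple G i | i < n].
  apply/allP => c _ /=; rewrite !count_map; apply/eqP.
  have E (H : 'I_n -> C) :
      count (preim id (preim H (pred1 c))) (Finite.enum 'I_n) = #|[set i | H i == c]|.
    by rewrite cardE /enum_mem size_filter; apply: eq_count => i; rewrite /= !inE.
  by rewrite !E.
exists s => i; have := congr1 (fun u => nth (F i) u i) sE.
by rewrite !(nth_mktuple) tnth_mktuple => ->.
Qed.

Section Isomorphism.
Variables (k n : nat).
Implicit Types (f g : {ffun 'I_n -> 'I_k}).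

Lemma complete_graph_iso (r : nat) f g (s : {perm 'I_n}) (t : {perm 'I_k}) :
  (forall i, g (s i) = t (f i)) ->
  graph_iso (complete_graph r f) (complete_graph r g).
Proof.
move=> h; exists s; apply/setP => e; rewrite /=.
have E (u : {set 'I_n}) : (s @: u \in complete_edges r g) = (u \in complete_edges r f).
  rewrite !inE card_imset; last exact: perm_inj.
  congr (_ && _); apply/forallP/forallP => hc c.
    apply: contra (hc (t c)) => /fintype.subsetP uc; apply/fintype.subsetP => _ /imsetP[i iu ->].
    by have := uc i iu; rewrite !inE h => /eqP->.
  apply: contra (hc (t^-1%g c)) => /fintype.subsetP uc; apply/fintype.subsetP => i iu.
  have := uc (s i) (imset_f _ iu); rewrite !inE h => /eqP <-.
  by rewrite permK.
have -> : e = s @: (s^-1%g @: e).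
  by rewrite -imset_comp -[LHS]imset_id; apply: eq_imset => i /=; rewrite permKV.
by rewrite mem_imset ?E //; apply: imset_inj; exact: perm_inj.
Qed.

Lemma sum_card_vclass f : (\sum_c #|vclass f c| = n)%N.
Proof.
rewrite -[RHS]card_ord -sum1_card (partition_big f predT) //=.
apply: eq_bigr => c _; rewrite -sum1_card; apply: eq_bigl => i.
by rewrite !inE.
Qed.

Lemma card_vclass_near f : (0 < k)%N ->
  (forall c d, (#|vclass f c| <= #|vclass f d| + 1)%N) ->
  forall c, (n %/ k <= #|vclass f c| <= (n %/ k).+1)%N.
Proof.
move=> k0 h c.
have sc (m : nat) : (\sum_(d < k) m = k * m)%N by rewrite sum_nat_const card_ord.
have nk := divn_eq n k; have := ltn_pmod n k0 => mk.
(* One class below the floor leaves at most the floor for each other class, so the total falls short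
   of n. The upper bound is dual. *)
have lo : (n %/ k <= #|vclass f c|)%N.
  rewrite leqNgt; apply/negP => lt.
  have : (\sum_d #|vclass f d| < \sum_(d < k) n %/ k)%N.
    rewrite (bigD1 c) //= [X in (_ < X)%N](bigD1 c) //= -addSn leq_add //.
    by apply: leq_sum => d _; apply: leq_trans (h d c) _; rewrite addn1.
  by rewrite sum_card_vclass sc; lia.
have hi : (#|vclass f c| <= (n %/ k).+1)%N.
  rewrite leqNgt; apply/negP => lt.
  have : (\sum_(d < k) (n %/ k).+1 < \sum_d #|vclass f d|)%N.
    rewrite (bigD1 c) //= [X in (_ < X)%N](bigD1 c) //= -addSn leq_add //.
    by apply: leq_sum => d _; rewrite -ltnS -(addn1 #|_|); apply: leq_trans (h c d).
  by rewrite sum_card_vclass sc; nia.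
by rewrite lo hi.
Qed.

(** Each class contributes the floor, and each large one a further 1. Thus the number of large
    classes depends on n and k alone. *)
Lemma card_large_vclasses f :
  (forall c, n %/ k <= #|vclass f c| <= (n %/ k).+1)%N ->
  (#|[set c | #|vclass f c| == (n %/ k).+1%N]| = n - k * (n %/ k))%N.
Proof.
move=> h; rewrite -[X in (X - _)%N](sum_card_vclass f).
rewrite (eq_bigr (fun c => n %/ k + (#|vclass f c| == (n %/ k).+1%N)))%N; last first.
  by move=> c _; have := h c; case: (ltngtP #|vclass f c| (n %/ k).+1); lia.
rewrite big_split /= sum_nat_const card_ord addKn -sum1_card big_mkcond /=.
by apply: eq_bigr => c _; rewrite inE; case: eqP.
Qed.

(** [fiber_perm] is applied twice: to colours, matching large classes with large ones, and then to
    vertices, matching the paired classes. *)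
Lemma balanced_iso (r : nat) f g :
  (forall c, n %/ k <= #|vclass f c| <= (n %/ k).+1)%N ->
  (forall c, n %/ k <= #|vclass g c| <= (n %/ k).+1)%N ->
  graph_iso (complete_graph r f) (complete_graph r g).
Proof.
move=> hf hg.
pose large (h : {ffun 'I_n -> 'I_k}) c := #|vclass h c| == (n %/ k).+1%N.
have [b|t tE] := @fiber_perm k bool (large f) (large g).
  have E (h : {ffun 'I_n -> 'I_k}) :
      (forall c, n %/ k <= #|vclass h c| <= (n %/ k).+1)%N ->
      #|[set c | large h c == b]| = (if b then n - k * (n %/ k) else k - (n - k * (n %/ k)))%N.
    move=> /card_large_vclasses; set A := [set c | _] => cA.
    have -> : [set c | large h c == b] = if b then A else ~: A.
      by case: b; apply/setP => c; rewrite !inE /A ?inE /large; case: (#|_| == _).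
    by case: b; rewrite // cardsCs finset.setCK card_ord cA.
  by rewrite !E.
have sz c : #|vclass g (t c)| = #|vclass f c|.
  have := tE c; rewrite /large.
  by have := hf c; have := hg (t c); lia.
have [c|s sE] := @fiber_perm n 'I_k (fun i => t (f i)) g.
  rewrite -[c](permKV t) sz; apply: eq_card => i; rewrite !inE.
  by rewrite (inj_eq perm_inj).
exact: complete_graph_iso sE.
Qed.

Lemma complete_edges_small f : (forall c, #|vclass f c| <= 2)%N ->
  complete_edges 3 f = [set e : {set 'I_n} | #|e| == 3].
Proof.
move=> h; apply/setP => e; rewrite !inE; case: eqP => //= e3.
apply/forallP => c; apply/negP => /subset_leq_card; rewrite e3 => h3.
by have := leq_trans h3 (h c).
Qed.

End Isomorphism.

Lemma maximal_pair_iso (R : realType) (k n : nat) (p : R) (f : {ffun 'I_n -> 'I_k})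
    (x : 'I_n -> R) (Q : unif_hypergraph 3 n) :
  (0 < k)%N -> 1 <= p -> maximal_pair p f x -> is_Q k Q ->
  graph_iso (complete_graph 3 f) Q.
Proof.
move=> k0 p1 mp [g [gQ hg]].
have ceil : ((n + k.-1) %/ k = (n %/ k)%N \/ (n + k.-1) %/ k = (n %/ k).+1)%N.
  have nk := divn_eq n k; have mk := ltn_pmod n k0.
  have -> : ((n + k.-1) %/ k = n %/ k + (n %% k + k.-1) %/ k)%N.
    by rewrite [in LHS]nk -addnA divnMDl.
  have [h|h] := ltnP (n %% k + k.-1) k; first by left; rewrite (divn_small h) addn0.
  have -> : (n %% k + k.-1 = 1 * k + (n %% k).-1)%N by lia.
  by right; rewrite divnMDl // (@divn_small (n %% k).-1) ?addn0 ?addn1 //; lia.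
have hg' c : (n %/ k <= #|vclass g c| <= (n %/ k).+1)%N.
  by case: (hg c) => ->; [|case: ceil => ->]; rewrite ?leqnn ?leqnSn.
have iso_Q : graph_iso (complete_graph 3 f) (complete_graph 3 g) ->
    graph_iso (complete_graph 3 f) Q.
  by move=> [s sE]; exists s; rewrite gQ -sE.
apply: iso_Q.
(* Sizes such as 2 and 0 escape [maximal_pair_balanced], which asks for a class of 3 vertices. In
   that case n <= 2 k, so the classes of [g] have at most 2 vertices too, and every triple is an
   edge for both colourings. *)
have [small|] := pselect (forall c, #|vclass f c| <= 2)%N.
  have n2k : (n <= k * 2)%N.
    rewrite -[X in (X <= _)%N](sum_card_vclass f).
    have -> : (k * 2 = \sum_(c < k) 2)%N by rewrite sum_nat_const card_ord.
    exact: leq_sum.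
  have q2 : (n %/ k <= 2)%N by rewrite -ltnS ltn_divLR //; lia.
  have small' c : (#|vclass g c| <= 2)%N.
    case: (hg c) => -> //; rewrite -ltnS ltn_divLR //; lia.
  exists 1%g; rewrite /= !complete_edges_small // -[LHS]imset_id.
  by apply: eq_imset => e; rewrite -[LHS]imset_id; apply: eq_imset => i; rewrite perm1.
move=> /existsNP[c0 /negP]; rewrite -ltnNge => c03.
apply: balanced_iso => //; apply: card_vclass_near => // c d.
have [c3|c3] := leqP 3 #|vclass f c|; first exact: (maximal_pair_balanced p1 d mp c3).
(* The class [c0] of at least 3 vertices forces at least 2 in [d], and [c] has at most 2 here. *)
have := maximal_pair_balanced p1 d mp c03; lia.
Qed.

(** * Monotonicity of the form and isomorphic graphs *)

Section Polyform.
Variables (R : realType) (r n : nat).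
Implicit Types (G H : unif_hypergraph r n) (x y : 'rV[R]_n).

Lemma polyform_le G x y : (forall i, `|x 0 i| <= y 0 i) -> polyform G x <= polyform G y.
Proof.
move=> xy; apply: ler_wpM2l => //; apply: ler_sum => e _.
apply: le_trans (ler_norm _) _; rewrite normr_prod.
by apply: ler_prod => i _; rewrite normr_ge0 xy.
Qed.

Lemma polyform_sub G H x : (forall i, 0 <= x 0 i) -> edges G \subset edges H ->
  polyform G x <= polyform H x.
Proof.
move=> x0 /fintype.subsetP GH; apply: ler_wpM2l => //.
rewrite big_mkcond [leRHS]big_mkcond /=; apply: ler_sum => e _.
case: ifP => [/GH -> //|_]; case: ifP => // _.
by apply: prodr_ge0 => i _.
Qed.

Lemma polyform_proper G H x : (forall i, 0 < x 0 i) -> edges G \proper edges H ->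
  polyform G x < polyform H x.
Proof.
move=> x0 /properP[GH [e eH eG]].
rewrite /polyform ltr_pM2l ?ltr0n ?fact_gt0 // (bigD1 e eH) /=.
apply: (@le_lt_trans _ _ (\sum_(e' in edges H | e' != e) \prod_(i in e') x 0 i)).
  rewrite big_mkcond [leRHS]big_mkcond /=; apply: ler_sum => e' _.
  case: ifP => [e'G|_].
    rewrite (fintype.subsetP GH) //= (_ : e' != e) //.
    by apply: contraNneq eG => <-.
  by case: ifP => // _; apply: prodr_ge0 => i _; apply: ltW.
by rewrite ltrDr; apply: prodr_gt0.
Qed.

Lemma p_spectral_radius_iso_le (p : R) G H : (0 < n)%N -> 1 <= p ->
  graph_iso G H -> p_spectral_radius p G <= p_spectral_radius p H.
Proof.
move=> n0 p1 [s sE].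
have [[x xS <-] _] := p_spectral_radius_max G n0 p1.
have [_ ub] := p_spectral_radius_max H n0 p1.
pose y := \row_i x 0 ((s^-1)%g i).
have -> : polyform G x = polyform H y.
  rewrite /polyform sE big_imset /=; last first.
    by move=> e e' _ _; apply: imset_inj; apply: perm_inj.
  congr (_ * _); apply: eq_bigr => e _.
  rewrite big_imset /=; last by move=> i j _ _; apply: perm_inj.
  by apply: eq_bigr => i _; rewrite mxE permK.
apply: ub; rewrite /lp_sphere /= (reindex_inj (@perm_inj _ s)) /= -[RHS]xS.
by apply: eq_bigr => i _; rewrite mxE permK.
Qed.

End Polyform.

(** * Existence of a maximal pair *)

Section Existence.
Variables (R : realType) (k n : nat) (p : R).
Hypotheses (p1 : 1 <= p) (n3 : (3 <= n)%N) (k2 : (2 <= k)%N).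
Implicit Types (f : {ffun 'I_n -> 'I_k}) (x y : 'I_n -> R).

Let n0 : (0 < n)%N. Proof. exact: leq_trans n3. Qed.
Let p0 : 0 < p. Proof. exact: lt_le_trans p1. Qed.

(* Raising one coordinate turns the inequality [\sum_i x i `^ p <= 1] into an equality. *)
Lemma complete_form_le_radius f x : lp_admissible p x ->
  complete_form f x <= p_spectral_radius p (complete_graph 3 f).
Proof.
move=> [x0 xp]; rewrite -polyform_complete.
pose i0 := Ordinal n0.
pose t := 1 - \sum_(i | i != i0) x i `^ p.
have xt : x i0 `^ p <= t by rewrite /t lerBrDr; move: xp; rewrite (bigD1 i0).
have t0 : 0 <= t by apply: le_trans xt; exact: powR_ge0.
have tp : (t `^ p^-1) `^ p = t by rewrite -powRrM mulVf ?gt_eqF // powRr1.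
pose y := \row_i (if i == i0 then t `^ p^-1 else x i).
apply: (@le_trans _ _ (polyform (complete_graph 3 f) y)).
  apply: polyform_le => i; rewrite !mxE ger0_norm //; case: eqP => // ->.
  rewrite -[leLHS]powRr1 // -(@mulfV _ p) ?gt_eqF // powRrM.
  by apply: ge0_ler_powR; rewrite ?invr_ge0 ?nnegrE ?powR_ge0 // ltW.
have [_ ub] := p_spectral_radius_max (complete_graph 3 f) n0 p1; apply: ub.
rewrite /lp_sphere /= (bigD1 i0) //= mxE eqxx ger0_norm ?powR_ge0 // tp.
rewrite (eq_bigr (fun i => x i `^ p)) ?subrK // => i /negPf ii0.
by rewrite mxE ii0 ger0_norm.
Qed.

Lemma abs_sphere_admissible (x : 'rV[R]_n) :
  lp_sphere n p x -> lp_admissible p (fun i => `|x 0 i|).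
Proof. by move=> xS; split=> [i //|]; rewrite le_eqVlt; apply/orP; left; apply/eqP. Qed.

Lemma exists_pos_complete_form :
  exists f x, lp_admissible p x /\ 0 < complete_form f x.
Proof.
have k0 : (0 < k)%N by exact: ltnW.
(* [Ordinal k2] is colour 1, as [2 <= k] unfolds to 1 < k. Only vertex 0 has colour 0, so the triple
   of vertices 0, 1, 2 is an edge. *)
pose f := [ffun i : 'I_n => if i == Ordinal n0 then Ordinal k0 else Ordinal k2].
exists f, (fun=> n%:R^-1).
have nR : 0 < n%:R^-1 :> R by rewrite invr_gt0 ltr0n.
split.
  split=> [i|]; first exact: ltW.
  apply: (@le_trans _ _ (\sum_(i < n) n%:R^-1)).
    apply: ler_sum => i _; apply: ge1r_powR => //.
    by rewrite nR invf_le1 ?ltr0n // ler1n.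
  by rewrite sumr_const card_ord -[leLHS]mulr_natl mulfV // pnatr_eq0 -lt0n.
rewrite -polyform_complete.
(* The empty graph has form 0, so strict monotonicity in the edge set yields positivity. *)
have uni0 : [forall e in (finset.set0 : {set {set 'I_n}}), #|e| == 3].
  by apply/forall_inP => e; rewrite inE.
have : polyform (UnifHypergraph uni0) (\row_(i < n) (n%:R^-1 : R)) <
       polyform (complete_graph 3 f) (\row_(i < n) (n%:R^-1 : R)).
  apply: polyform_proper => [i|]; first by rewrite mxE.
  rewrite /= proper0; apply/set0Pn; exists (widen_ord n3 @: [set: 'I_3]).
  rewrite inE card_imset ?cardsT ?card_ord ?eqxx /=; last first.
    by move=> i j /(congr1 val) /= ?; apply: val_inj.
  apply/forallP => c; apply/negP => /fintype.subsetP sub.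
  have := sub _ (imset_f (widen_ord n3) (finset.in_setT (inord 0))).
  have := sub _ (imset_f (widen_ord n3) (finset.in_setT (inord 1))).
  by rewrite !inE !ffunE -!val_eqE /= !inordK //= => /eqP <-.
by rewrite [polyform (UnifHypergraph _) _]/polyform /= big_set0 mulr0.
Qed.

Lemma exists_maximal_pair : exists f x,
  maximal_pair p f x /\ complete_form f x = p_spectral_radius p (complete_graph 3 f).
Proof.
have [f0 [x0 [ax0 F0]]] := exists_pos_complete_form.
(* There are finitely many colourings and each radius is attained, so the joint maximum exists. *)
have [f _ fmax] := arg_maxP (fun f => p_spectral_radius p (complete_graph 3 f)) (isT : predT f0).
have [[z zS zE] _] := p_spectral_radius_max (complete_graph 3 f) n0 p1.
pose x i := `|z 0 i|; have ax : lp_admissible p x := abs_sphere_admissible zS.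
have E : complete_form f x = p_spectral_radius p (complete_graph 3 f).
  apply/eqP; rewrite eq_le complete_form_le_radius //= -zE -polyform_complete.
  by apply: polyform_le => i; rewrite mxE.
have M f' y : lp_admissible p y -> complete_form f' y <= complete_form f x.
  by move=> ay; rewrite E; apply: le_trans (complete_form_le_radius f' ay) (fmax f' isT).
exists f, x; split=> //; split=> //.
exact: lt_le_trans F0 (M f0 x0 ax0).
Qed.

End Existence.

(** * Comparison of a k-chromatic graph with the balanced one *)

Lemma edges_small (r n : nat) (G : unif_hypergraph r n) : (n < r)%N -> edges G = finset.set0.
Proof.
move=> nr; apply/setP => e; rewrite inE; apply/negP => eG.
have /forall_inP/(_ e eG)/eqP er := edges_uniform G.
by have := max_card (mem e); rewrite er card_ord leqNgt nr.
Qed.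

Theorem theorem4 (R : realType) (k n : nat) (hk : (2 <= k)%N)
  (G Q : unif_hypergraph 3 n) (hG : chromatic k G) (hQ : is_Q k Q)
  (p : R) (hp : 1 <= p) :
  ~ graph_iso G Q -> p_spectral_radius p G < p_spectral_radius p Q.
Proof.
move=> nGQ; have [n3|n3] := leqP 3 n; last first.
  by case: nGQ; exists 1%g; rewrite !edges_small // imset0.
have n0 : (0 < n)%N by exact: leq_trans n3.
have k0 : (0 < k)%N by exact: ltnW.
have [f hf] := hG.
have sub : edges G \subset complete_edges 3 f.
  apply/fintype.subsetP => e eG; rewrite inE.
  have /forall_inP/(_ e eG) -> /= := edges_uniform G.
  by apply/forallP => c; apply: hf.
(* The optimal [complete_graph 3 g] is isomorphic to [Q], so the radius of [Q] bounds the forms of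
   all colourings. *)
have [g [z [mp zE]]] := exists_maximal_pair hp n3 hk.
have zQ : complete_form g z <= p_spectral_radius p Q.
  by rewrite zE; apply: p_spectral_radius_iso_le => //; apply: maximal_pair_iso mp hQ.
have [[x xS <-] _] := p_spectral_radius_max G n0 hp.
pose y i := `|x 0 i|; have ay : lp_admissible p y := abs_sphere_admissible xS.
have xy : polyform G x <= polyform G (\row_i y i).
  by apply: polyform_le => i; rewrite mxE.
have Gf : polyform G (\row_i y i) <= complete_form f y.
  rewrite -polyform_complete; apply: polyform_sub => // i; rewrite mxE.
  exact: normr_ge0.
have [az z0 M] := mp.
have fg : complete_form f y <= complete_form g z := M f y ay.
(* Otherwise the chain from [polyform G x] up to the radius of [Q] closes into equalities. Then [f]
   with [y] is a maximal pair, and its complete graph is isomorphic to [Q]. *)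
rewrite ltNge; apply/negP => Qx; apply: nGQ.
have fgE : complete_form f y = complete_form g z.
  by apply/eqP; rewrite eq_le fg /=; apply: le_trans zQ (le_trans Qx (le_trans xy Gf)).
have mpf : maximal_pair p f y by split; rewrite ?fgE.
have [s sE] := maximal_pair_iso k0 hp mpf hQ.
suff GE : edges G = complete_edges 3 f by exists s; rewrite sE GE.
(* Since [y] is positive everywhere, an edge missing from [G] would make an equality of the chain
   strict. *)
apply/eqP; rewrite eqEproper sub /=; apply/negP => prop.
have y0 i : 0 < (\row_i y i) 0 i by rewrite mxE; exact: (maximal_pair_pos hp _ mpf).
have := @polyform_proper _ _ _ G (complete_graph 3 f) _ y0 prop.
rewrite polyform_complete fgE ltNge => /negP; apply.
exact: le_trans zQ (le_trans Qx xy).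
Qed.
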